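(* Let $G$ be a connected graph of diameter $2$ that has exactly $k\geq 1$ bridges. Then $rc(G)\leq k+2$.
   Context: All graphs are finite, simple and undirected. A bridge is an edge whose removal disconnects the graph. In an edge-colored graph (adjacent edges may receive the same color), a path is a rainbow path if no two of its edges have the same color. The rainbow connection number $rc(G)$ of a connected graph $G$ is the minimum integer $i$ such that there is an edge-coloring of $G$ with $i$ colors in which every two distinct vertices of $G$ are connected by a rainbow path. *)

(* Defs.v *)
From mathcomp Require Import all_boot.
From mathcomp Require Import boolp.

Set Implicit Arguments.
Unset Strict Implicit.
Unset Printing Implicit Defensive.

Record sgraph := SGraph {
  vertex :> finType;
  adj : rel vertex;
  adj_sym : symmetric adj;
  adj_irrefl : irreflexive adj
}.

Definition edges (G : sgraph) : {set {set G}} :=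
  [set [set x; y] | x in G, y in G & adj x y].

Definition connected (G : sgraph) : bool :=
  [forall x : G, forall y : G, connect (@adj G) x y].

(* As in [path], a path from x to y is given by its vertices after x;
   its length is [size p], and its vertices are pairwise distinct. *)
Definition is_path (G : sgraph) (x y : G) (p : seq G) : bool :=
  [&& path (@adj G) x p, last x p == y & uniq (x :: p)].

Definition path_edges (G : sgraph) (x : G) (p : seq G) : seq {set G} :=
  pairmap (fun u v => [set u; v]) x p.

Section DeleteEdge.

Variables (G : sgraph) (E : {set G}).

Definition del_adj : rel G := fun x y => adj x y && ([set x; y] != E).

Lemma del_adj_sym : symmetric del_adj.
Proof. by move=> x y; rewrite /del_adj adj_sym setUC. Qed.

Lemma del_adj_irrefl : irreflexive del_adj.
Proof. by move=> x; rewrite /del_adj adj_irrefl. Qed.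

Definition del_edge : sgraph := SGraph del_adj_sym del_adj_irrefl.

End DeleteEdge.

(* Intended for connected G: a bridge is an edge whose removal leaves a
   disconnected graph. *)
Definition bridges (G : sgraph) : {set {set G}} :=
  [set E in edges G | ~~ connected (del_edge E)].

Lemma connected_path (G : sgraph) (x y : G) :
  connected G -> exists p, is_path x y p.
Proof.
move=> /forallP/(_ x)/forallP/(_ y)/connectP[p pth ->].
have [q pq uq _] := shortenP pth.
by exists q; rewrite /is_path pq eqxx uq.
Qed.

Section Distance.

Variables (G : sgraph) (connG : connected G).

Lemma dist_exists (x y : G) : exists n, [exists p : n.-tuple G, is_path x y p].
Proof.
have [p pP] := connected_path x y connG.
by exists (size p); apply/existsP; exists (in_tuple p).
Qed.

Definition dist (x y : G) : nat := ex_minn (dist_exists x y).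

Definition diameter : nat := \max_(x : G) \max_(y : G) dist x y.

End Distance.

Definition rainbow_path (G : sgraph) (c : {set G} -> nat) (x y : G) (p : seq G)
  : bool := is_path x y p && uniq (map c (path_edges x p)).

(* The colours are 0, ..., i.-1; only the values of c on edges matter. *)
Definition rainbow_colorable (G : sgraph) (i : nat) : Prop :=
  exists c : {set G} -> nat,
    {in edges G, forall E, c E < i} /\
    forall x y : G, x != y -> exists p, rainbow_path c x y p.

Section RainbowConnection.

Variables (G : sgraph) (connG : connected G).

Lemma path_edgesP (x : G) p :
  path (@adj G) x p -> {subset path_edges x p <= edges G}.
Proof.
elim: p x => [|y p IHp] x //= /andP[xy pth] E.
rewrite inE => /predU1P[->|]; last exact: IHp.
by apply/imset2P; exists x y; rewrite ?inE.
Qed.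

Lemma path_edges_cover (x : G) p E :
  E \in path_edges x p -> {subset E <= x :: p}.
Proof.
elim: p x => [|y p IHp] x //=.
rewrite inE => /predU1P[->|Ep] z.
  by rewrite !inE => /orP[]/eqP->; rewrite eqxx ?orbT.
by move/(IHp _ Ep) => zp; rewrite in_cons zp orbT.
Qed.

Lemma path_edges_uniq (x : G) p : uniq (x :: p) -> uniq (path_edges x p).
Proof.
elim: p x => [|y p IHp] x // /andP[xNp up] /=; rewrite IHp // andbT.
apply/negP => /path_edges_cover/(_ x); rewrite !inE eqxx => /(_ isT) xp.
by move: xNp; rewrite in_cons xp.
Qed.

Lemma rainbow_exists : exists i, `[< rainbow_colorable G i >].
Proof.
exists #|edges G|; apply/asboolP; exists (fun E => index E (enum (edges G))).
split=> [E EG|x y _]; first by rewrite cardE index_mem mem_enum.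
have [p pP] := connected_path x y connG; exists p.
rewrite /rainbow_path pP /=; case/and3P: pP => pth _ up.
rewrite map_inj_in_uniq ?path_edges_uniq // => E F Ep Fp eqEF.
by rewrite -(nth_index E (s := enum (edges G)) (x := E)) ?eqEF ?nth_index //
   mem_enum (path_edgesP pth).
Qed.

Definition rc : nat := ex_minn rainbow_exists.

End RainbowConnection.

(* Main.v *)
Require Import Defs.
From mathcomp Require Import all_boot.
From mathcomp Require Import boolp.

Set Implicit Arguments.
Unset Strict Implicit.
Unset Printing Implicit Defensive.

(** Deleting a bridge of a graph of diameter 2 leaves a side with a single
    vertex, hence the other end v of the bridge is adjacent to all other
    vertices. Edges in triangles are not bridges, so all bridges contain v, and
    every x such that vx is not a bridge has a neighbour x' <> v such that vx'
    is not a bridge either. Let A be a maximal independent set of the graph H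
    induced by these vertices: every vertex of H has an H-neighbour on the
    other side of the partition (A, H \ A). Give the k bridges distinct
    colours, the other edges vx one of two new colours according to whether x
    is in A, and reuse the colour of a bridge on the edges of H. Two vertices x,
    y on the same side are then connected by x x' v y, where x' is a neighbour
    of x on the other side. *)

Lemma dist_le2_cases (G : sgraph) (connG : connected G) (x y : G) :
  dist connG x y <= 2 ->
  [\/ x = y, adj x y | exists2 z, adj x z & adj z y].
Proof.
rewrite /dist; case: ex_minnP => n /existsP[p /and3P[pth /eqP lst _]] _.
rewrite -(size_tuple p).
case: (tval p) pth lst => [|z [|t [|//]]] /=.
- by move=> _ ->; constructor 1.
- by rewrite andbT => xz <-; constructor 2.
- by rewrite andbT => /andP[xz zt] <- _; constructor 3; exists z.
Qed.

Lemma dist_le_diameter (G : sgraph) (connG : connected G) (x y : G) :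
  dist connG x y <= diameter connG.
Proof.
apply: (@leq_trans (\max_(y' : G) dist connG x y')).
  exact: (leq_bigmax (F := fun y' => dist connG x y')).
exact: (leq_bigmax (F := fun x' => \max_(y' : G) dist connG x' y')).
Qed.

Lemma edgesP (G : sgraph) (E : {set G}) :
  reflect (exists x y, adj x y /\ E = [set x; y]) (E \in edges G).
Proof.
apply: (iffP imset2P) => [[x y _]|[x [y [xy ->]]]].
  by rewrite inE => /andP[_ xy] ->; exists x, y.
by exists x y; rewrite ?inE.
Qed.

Lemma set2_edges (G : sgraph) (x y : G) : adj x y -> [set x; y] \in edges G.
Proof. by move=> xy; apply/edgesP; exists x, y. Qed.

(** A walk of [G] survives the deletion once each use of the edge ab is replaced by a detour between
    [a] and [b]. *)
Lemma connected_del_edge (G : sgraph) (a b : G) :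
  connected G -> connect (@del_adj G [set a; b]) a b ->
  connected (del_edge [set a; b]).
Proof.
move=> connG ab; apply/forallP => x; apply/forallP => y.
have /connect_sub sub : forall u w : G, adj u w ->
    connect (@del_adj G [set a; b]) u w.
  move=> u w uw; have [uwE|uwNE] := eqVneq [set u; w] [set a; b]; last first.
    by apply: connect1; rewrite /del_adj uw.
  have ba : connect (@del_adj G [set a; b]) b a.
    by rewrite (sym_connect_sym (@del_adj_sym G _)).
  have: u \in [set a; b] by rewrite -uwE !inE eqxx.
  have: w \in [set a; b] by rewrite -uwE !inE eqxx orbT.
  by rewrite !inE => /orP[]/eqP-> /orP[]/eqP->.
by apply: sub; move/forallP: connG => /(_ x)/forallP/(_ y).
Qed.

Lemma set2_neq (T : finType) (x y a b : T) :
  x != a -> x != b -> [set x; y] != [set a; b].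
Proof.
move=> xa xb; apply/eqP => /setP/(_ x).
by rewrite !inE eqxx (negPf xa) (negPf xb).
Qed.

(** The detour x, y, z avoids the deleted edge, since [y] differs from both [x] and [z]. *)
Lemma triangle_not_bridge (G : sgraph) (x y z : G) :
  connected G -> adj x y -> adj y z -> [set x; z] \notin bridges G.
Proof.
move=> connG xy yz; rewrite inE negb_and negbK; apply/orP; right.
have neq (u w : G) : adj u w -> w != u.
  by move=> uw; apply: contraTneq uw => ->; rewrite adj_irrefl.
have yNx := neq _ _ xy; have yNz : y != z by rewrite eq_sym neq.
apply: connected_del_edge => //; apply: (@connect_trans _ _ y); apply: connect1.
  by rewrite /del_adj xy setUC set2_neq.
by rewrite /del_adj yz set2_neq.
Qed.

(** If each side of the bridge ab had a vertex besides its end, a path of length at most 2 between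
    two such vertices would have every edge incident to one of them, so it would avoid ab and join
    the sides. *)
Lemma bridge_dominating_vertex (G : sgraph) (connG : connected G) E :
  diameter connG <= 2 -> E \in bridges G ->
  exists v : G, forall x, x != v -> adj v x.
Proof.
move=> diam; rewrite inE => /andP[/edgesP[a [b [ab ->]]]] disc.
have dist2 (x y : G) : [\/ x = y, adj x y | exists2 z, adj x z & adj z y].
  by apply/(dist_le2_cases (connG := connG))/(leq_trans _ diam)/dist_le_diameter.
set e := @del_adj G [set a; b].
have esym : connect_sym e by apply: sym_connect_sym; apply: del_adj_sym.
have bNa : ~~ connect e a b.
  by apply: contra disc; apply: connected_del_edge.
(* A leaf [u] can reach the other vertices within two steps only through its neighbour [v]. *)
have leaf_dom (u v : G) : (forall z, adj u z -> z = v) -> adj u v ->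
    forall x, x != v -> adj v x.
  move=> leaf uv x xv; case: (dist2 u x) => [<-|/leaf xE|[z /leaf-> //]].
    by rewrite adj_sym.
  by rewrite xE eqxx in xv.
(* If [a] is alone on its side, it is a leaf and [b] dominates; the next case distinction exchanges
   the two ends. *)
case: (boolP [exists x, (x != a) && connect e a x]); last first.
  rewrite negb_exists => /forallP aS; exists b; apply: (leaf_dom a) => // z az.
  apply/eqP; apply: contraNT (aS z) => zb.
  have za : z != a by apply: contraTneq az => ->; rewrite adj_irrefl.
  by rewrite za connect1 // /e /del_adj az setUC set2_neq.
case/existsP => x /andP[xa ax].
case: (boolP [exists y, (y != b) && ~~ connect e a y]); last first.
  rewrite negb_exists => /forallP bS; exists a.
  apply: (leaf_dom b); last by rewrite adj_sym.
  move=> z bz; apply/eqP; apply: contraNT bNa => za.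
  have zb : z != b by apply: contraTneq bz => ->; rewrite adj_irrefl.
  move: (bS z); rewrite zb negbK /= => /connect_trans; apply.
  by apply: connect1; rewrite /e /del_adj adj_sym bz set2_neq.
case/existsP => y /andP[yb ayN].
have xb : x != b by apply: contraNneq bNa => <-.
have ya : y != a by apply: contraNneq ayN => ->.
case/negP: ayN; apply: connect_trans ax _; case: (dist2 x y) => [-> //|xy|].
  by apply: connect1; rewrite /e /del_adj xy set2_neq.
case=> z xz zy; apply: (@connect_trans _ _ z); apply: connect1.
  by rewrite /e /del_adj xz set2_neq.
by rewrite /e /del_adj zy setUC set2_neq.
Qed.

(** After the deletion of vx, a path from [x] to [v] must start with an edge to a vertex other than
    [v]. *)
Lemma not_bridge_neighbor (G : sgraph) (v x : G) :
  adj v x -> [set v; x] \notin bridges G -> exists2 y, adj x y & y != v.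
Proof.
move=> vx; rewrite inE set2_edges //= negbK.
move=> /forallP/(_ x)/forallP/(_ v)/connectP[[|y p] /=].
  by move=> _ vE; rewrite vE adj_irrefl in vx.
case/andP => /andP[xy xyE] _ _; exists y => //.
by apply: contraNneq xyE => ->; rewrite setUC.
Qed.

Lemma opposite_neighbors (G : sgraph) (H : {set G}) :
  (forall x, x \in H -> exists2 y, y \in H & adj x y) ->
  exists2 A : {set G}, A \subset H &
    forall x, x \in H ->
      exists y, [/\ y \in H, adj x y & (y \in A) = (x \notin A)].
Proof.
move=> nbr.
pose indep (A : {set G}) :=
  (A \subset H) && [forall x in A, forall y in A, ~~ adj x y].
have indep0 : indep set0.
  by rewrite /indep sub0set; apply/forall_inP => x; rewrite inE.
have [A /maxsetP[/andP[AH /forall_inP indA] maxA] _] := maxset_exists indep0.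
have indepA (x y : G) : x \in A -> y \in A -> ~~ adj x y.
  by move=> /indA/forall_inP; apply.
exists A => // x xH; have [xA|xNA] := boolP (x \in A).
  (* Inside [A], independence puts every neighbour on the other side; outside [A], maximality
     provides a neighbour in [A]. *)
  have [y yH xy] := nbr x xH; exists y; split=> //.
  by apply: contraTF xy => yA; apply: indepA.
case: (boolP [exists y in A, adj x y]) => [/exists_inP[y yA xy]|].
  by exists y; rewrite (subsetP AH).
rewrite negb_exists_in => /forall_inP xN; case/negP: (xNA).
suff /maxA<- : indep (x |: A) by rewrite ?setU11 ?subsetUr.
rewrite /indep subUset sub1set xH AH /=; apply/forall_inP => y yxA.
apply/forall_inP => z; move: yxA; rewrite !in_setU1.
case/predU1P=> [->|yA] /predU1P[->|zA].
- by rewrite adj_irrefl.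
- exact: xN.
- by rewrite adj_sym xN.
- exact: indepA.
Qed.

Theorem theorem7 (G : sgraph) (connG : connected G) (k : nat) :
  diameter connG = 2 -> 1 <= k -> #|bridges G| = k -> rc connG <= k + 2.
Proof.
move=> diam k_gt0 kE.
have [E0 E0b] : exists E, E \in bridges G by apply/card_gt0P; rewrite kE.
have [v dom] : exists v : G, forall x, x != v -> adj v x.
  by apply: (bridge_dominating_vertex (connG := connG)) E0b; rewrite diam.
pose H := [set x | (x != v) && ([set v; x] \notin bridges G)].
have nbrH x : x \in H -> exists2 y, y \in H & adj x y.
  rewrite inE => /andP[xv xb].
  have [y xy yv] := not_bridge_neighbor (dom x xv) xb; exists y => //.
  by rewrite inE yv (triangle_not_bridge (y := x)) ?dom.
have [A AH opp] := opposite_neighbors nbrH.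
have vNA : v \notin A.
  by apply/negP => /(subsetP AH); rewrite inE eqxx.
(* As [v] is not in [A], the test [E \subset ~: A] asks whether the other end of a spoke lies
   outside [A]. Edges that are neither bridges nor spokes share colour 0 with a bridge. *)
pose c E := if E \in bridges G then index E (enum (bridges G))
            else if v \in E then k + (E \subset ~: A) else 0.
have c_bridge E : E \in bridges G -> c E < k.
  by move=> Eb; rewrite /c Eb -kE cardE index_mem mem_enum.
have c_bridge_inj : {in bridges G &, injective c}.
  move=> E F Eb Fb; rewrite /c Eb Fb => EF.
  by apply: (index_inj E _ _ EF); rewrite mem_enum.
have c_spoke x : x \in H -> c [set v; x] = k + (x \notin A).
  rewrite inE => /andP[_ /negPf xb].
  by rewrite /c xb !inE eqxx /= subUset !sub1set !inE vNA.
have c_rim x y : x \in H -> y \in H -> c [set x; y] = 0.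
  rewrite !inE => /andP[xv _] /andP[yv _].
  have /negPf xyb : [set x; y] \notin bridges G.
    by rewrite (triangle_not_bridge (y := v)) // ?dom // adj_sym dom.
  by rewrite /c xyb !inE eq_sym (negPf xv) eq_sym (negPf yv).
rewrite /rc; case: ex_minnP => m _; apply; apply/asboolP; exists c; split.
  move=> E _; have [/c_bridge cE|/negPf Eb] := boolP (E \in bridges G).
    by rewrite ltn_addr.
  rewrite /c Eb; case: ifP => _; last by rewrite addn2.
  by rewrite ltn_add2l; case: (_ \subset _).
move=> x y xy; have [xv|xv] := eqVneq x v.
  exists [:: y]; rewrite /rainbow_path /is_path /= !inE xy eqxx !andbT xv.
  by rewrite dom // -xv eq_sym.
have [yv|yv] := eqVneq y v.
  exists [:: y]; rewrite /rainbow_path /is_path /= !inE xy eqxx !andbT yv.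
  by rewrite adj_sym dom.
have through_v : c [set v; x] != c [set v; y] ->
    exists p, rainbow_path c x y p.
  move=> cxy; exists [:: v; y].
  rewrite /rainbow_path /is_path /= !inE negb_or xv xy eqxx !andbT.
  by rewrite adj_sym !dom //= (eq_sym v) yv setUC.
have inH z : z != v -> (z \in H) = ([set v; z] \notin bridges G).
  by move=> zv; rewrite inE zv.
have [xH|xNH] := boolP (x \in H); have [yH|yNH] := boolP (y \in H).
(* Equal spoke colours mean the same side, so the path first steps from [x] to a neighbour [z] on
   the other side. *)
- have [cxy|] := eqVneq (c [set v; x]) (c [set v; y]); last exact: through_v.
  have [z [zH xz zA]] := opp x xH.
  have zv : z != v by move: zH; rewrite inE => /andP[].
  have xyA : (x \in A) = (y \in A).
    by move/eqP: cxy; rewrite !c_spoke // eqn_add2l; do 2![case: (_ \in A)].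
  have zy : z != y.
    by apply: contra_eq_neq zA => ->; rewrite xyA; case: (_ \in A).
  have xNz : x != z by apply: contraTneq xz => ->; rewrite adj_irrefl.
  exists [:: z; v; y]; rewrite /rainbow_path /is_path /= !inE !negb_or.
  rewrite xz (adj_sym z) !dom // xv xy xNz zv zy eq_sym yv eqxx /= !andbT.
  rewrite (setUC [set z]) c_rim // !c_spoke // zA xyA negbK.
  (* Since [k] is positive, colour 0 of the edge xz differs from the spoke colours [k] and
     [k + 1]. *)
  by rewrite eqn_add2l; case: (k) k_gt0 => // n _; case: (_ \in A).
(* A bridge has a colour below [k], any other spoke one of at least [k]. *)
- apply: through_v; rewrite inH // negbK in yNH.
  by rewrite neq_ltn (leq_trans (c_bridge _ yNH)) ?orbT // c_spoke // leq_addr.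
- apply: through_v; rewrite inH // negbK in xNH.
  by rewrite neq_ltn (leq_trans (c_bridge _ xNH)) // c_spoke // leq_addr.
- apply: through_v; rewrite inH // negbK in xNH; rewrite inH // negbK in yNH.
  apply: contra_neq xy => /(c_bridge_inj _ _ xNH yNH)/setP/(_ x).
  by rewrite !inE eqxx orbT (negPf xv) /= => /esym/eqP.
Qed.
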